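(* Let $K$ be a field, let $S=K[t_1,\ldots,t_s]$ be a polynomial ring with the standard grading, and let $I\subset S$ be a monomial ideal minimally generated by the set of monomials $G(I)$. For each variable $t_i$ that occurs in a monomial of $G(I)$, let $\gamma_i:=\max\{\deg_{t_i}(g)\mid g\in G(I)\}$. Then $${\rm reg}(S/I)\leq\dim(S/I)+\sum_i(\gamma_i-1),$$ where the sum is over all $i$ such that $t_i$ occurs in a monomial of $G(I)$.
   Context: $\dim(S/I)$ is the Krull dimension. ${\rm reg}(S/I)$ is the Castelnuovo–Mumford regularity: $\max\{j-i\mid b_{i,j}\neq0\}$, where $b_{i,j}$ are the graded Betti numbers of the minimal graded free resolution of $S/I$ over $S$ (the $i$-th free module being $\bigoplus_jS(-j)^{b_{i,j}}$). $G(I)$ is the unique minimal set of monomial generators of $I$, and $\deg_{t_i}(g)$ is the exponent of $t_i$ in the monomial $g$. *)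

(* Defs.v *)
From HB Require Import structures.
From mathcomp Require Import all_boot all_order all_algebra.
From mathcomp Require Import finmap.
From mathcomp.multinomials Require Import mpoly.

Set Implicit Arguments.
Unset Strict Implicit.
Unset Printing Implicit Defensive.

Import Order.TTheory GRing.Theory Num.Theory.

Local Open Scope ring_scope.
Local Open Scope fset_scope.
Local Open Scope quotient_scope.

Section Generators.
Variables (K : fieldType) (s : nat).

Definition generated_by_monomials (I : {pred {mpoly K[s]}})
    (G : {fset 'X_{1..s}}) : Prop :=
  forall p : {mpoly K[s]},
    p \in I <-> exists c : 'X_{1..s} -> {mpoly K[s]},
                  p = \sum_(g <- G) c g * 'X_[g].

Definition minimal_monomial_generators (I : {pred {mpoly K[s]}})
    (G : {fset 'X_{1..s}}) : Prop :=
  generated_by_monomials I G /\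
  forall H : {fset 'X_{1..s}},
    H `<=` G -> generated_by_monomials I H -> H = G.

Definition occurs (G : {fset 'X_{1..s}}) (i : 'I_s) : bool :=
  has (fun g : 'X_{1..s} => (0 < g i)%N) G.

Definition gamma (G : {fset 'X_{1..s}}) (i : 'I_s) : nat :=
  (\max_(g <- G) g i)%N.

End Generators.

(* A chain P 0 < ... < P n of prime ideals has length n; the values of P
   beyond n are irrelevant. *)
Definition has_prime_chain (R : comNzRingType) (n : nat) : Prop :=
  exists P : nat -> prime_idealr R,
    forall i, (i < n)%N ->
      {subset P i <= P i.+1} /\ ~ {subset P i.+1 <= P i}.

Definition is_krull_dim (R : comNzRingType) (d : nat) : Prop :=
  has_prime_chain R d /\ forall n, has_prime_chain R n -> (n <= d)%N.

Section Resolution.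
Variables (K : fieldType) (s : nat).

(* The integer-degree version of [p \is n.-homog]: for negative z only p = 0
   qualifies. *)
Definition zhomog (z : int) (p : {mpoly K[s]}) : Prop :=
  {in msupp p, forall m, (mdeg m)%:Z = z}.

(* The i-th free module is the direct sum over k of S(- mgr_shift i k), its
   elements being row vectors on which the differentials act by right
   multiplication; the k-th basis vector of S(-j) has degree j. All maps are
   graded of degree 0. The complex may a priori be infinite, ranks being
   allowed to vanish. *)
Record minimal_graded_resolution (I : idealr {mpoly K[s]}) := MinGradedRes {
  mgr_rank : nat -> nat;
  mgr_shift : forall i, 'I_(mgr_rank i) -> int;
  mgr_diff : forall i, 'M[{mpoly K[s]}]_(mgr_rank i.+1, mgr_rank i);
  (* images of the basis of the 0-th module under the augmentation onto S/I *)
  mgr_augb : 'I_(mgr_rank 0) -> {ideal_quot I};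
  mgr_aug := fun u : 'rV[{mpoly K[s]}]_(mgr_rank 0) =>
    \sum_k \pi_{ideal_quot I} (u ord0 k) * mgr_augb k;
  mgr_diff_graded : forall i k l,
    zhomog (mgr_shift k - mgr_shift l) (mgr_diff i k l);
  mgr_aug_graded : forall k,
    exists2 p, zhomog (mgr_shift k) p & mgr_augb k = \pi_{ideal_quot I} p;
  mgr_aug_surj : forall q, exists u, mgr_aug u = q;
  mgr_exact0 : forall u,
    mgr_aug u = 0 <-> exists v, u = v *m mgr_diff 0;
  mgr_exactS : forall i (u : 'rV_(mgr_rank i.+1)),
    u *m mgr_diff i = 0 <-> exists v, u = v *m mgr_diff i.+1;
  (* the image of each differential lies in (t_1,...,t_s) times its target *)
  mgr_minimal : forall i k l, (mgr_diff i k l)@_(0%MM) = 0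
}.

Definition betti (I : idealr {mpoly K[s]}) (F : minimal_graded_resolution I)
    (i : nat) (j : int) : nat :=
  #|[set k : 'I_(mgr_rank F i) | mgr_shift (m := F) k == j]|.

(* [r] is the regularity of S/I (not of I). Minimal resolutions of S/I being
   unique up to isomorphism, the choice of F is immaterial. *)
Definition is_regularity (I : idealr {mpoly K[s]}) (r : int) : Prop :=
  exists F : minimal_graded_resolution I,
    (exists i j, betti F i j <> 0%N /\ r = j - i%:Z) /\
    (forall i j, betti F i j <> 0%N -> j - i%:Z <= r).

End Resolution.

(* Main.v *)
Require Import Defs.
From HB Require Import structures.
From mathcomp Require Import all_boot all_order all_algebra.
From mathcomp Require Import finmap.
From mathcomp.multinomials Require Import mpoly.
From mathcomp Require Import zify.

Set Implicit Arguments.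
Unset Strict Implicit.
Unset Printing Implicit Defensive.

Import Order.TTheory GRing.Theory Num.Theory.
Local Open Scope ring_scope.

(**
The Betti number b_(i,j) counts the basis vectors of degree j in the i-th
module of the minimal resolution F, and it is also the dimension of the
degree j part of the i-th Koszul homology of S/I. In contrast to F, the Koszul
complex of S/I is explicit and multigraded: in multidegree a it has the
basis t^m e_A, where A is a set of variables, m + A = a and t^m is not in I.
If a_k > gamma_k for some k, then membership of t^m in I does not depend on
whether one factor t_k is moved between t^m and e_A, so toggling k is a
contracting homotopy and this multidegree has no homology. Hence b_(i,j) <> 0
yields a set A of i variables and a monomial t^m outside I, of degree j - i,
with m_k <= gamma_k for all k.

Let T be the set of occurring variables with m_k = gamma_k. Then j - i, the
degree of t^m, is at most |T| plus the sum of the gamma_k - 1. No generator is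
a monomial in the variables of T alone, as it would divide t^m. So the primes
generated by the variables outside T and some of those in T contain I; adding
the variables of T one by one gives a chain of length |T|, whence
|T| <= dim (S/I).

The passage from F to the Koszul complex is the zigzag that proves
Tor symmetric, carried out on elements of (Koszul complex) tensor F. A basis
vector of F_i, placed in Koszul degree 0, is lifted step by step to Koszul
degree i over F_0; there the toggling homotopy makes it a boundary modulo I;
descending again, the basis vector is the sum of a Koszul boundary and of an
element of the image of F_(i+1), hence lies in (t_1,...,t_s) F_i
by minimality, which is absurd. The steps of the lift use that the Koszul
complex of S itself is exact, which is proved by the same toggling homotopy.
The homotopy is [toggle_homotopy] and [contraction_homotopy], the two exactness
results are [koszul_exact] and [koszul_quotient_exact], the zigzag is
[koszul_zigzag], and the dimension bound is [krull_dim_ge_card_free_vars].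
*)

(** * The boundary of the full simplex *)

Section SimplexBoundary.
Variables (R : comNzRingType) (s : nat).
Implicit Types (A B : {set 'I_s}) (k l : 'I_s) (c : {set 'I_s} -> R).

Definition koszul_sign l A : R := (-1) ^+ #|[set j in A | (j < l)%N]|.

Lemma koszul_signK l A : koszul_sign l A * koszul_sign l A = 1.
Proof. by rewrite -expr2 sqrr_sign. Qed.

Lemma koszul_signU k l A : k \notin A ->
  koszul_sign l (k |: A) = (-1) ^+ (k < l)%N * koszul_sign l A.
Proof.
move=> kA; rewrite /koszul_sign.
have -> : [set j in k |: A | (j < l)%N] =
    if (k < l)%N then k |: [set j in A | (j < l)%N] else [set j in A | (j < l)%N].
  apply/setP=> j; have [->|njk] := eqVneq j k; case: ifP => kl.
  - by rewrite !inE eqxx kl.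
  - by rewrite !inE kl !andbF.
  - by rewrite !inE (negPf njk).
  - by rewrite !inE (negPf njk).
case: ifP => kl; last by rewrite mul1r.
by rewrite cardsU1 inE (negPf kA) /= exprD.
Qed.

Lemma koszul_sign_swap k l A : k != l -> k \notin A -> l \notin A ->
  koszul_sign k A * koszul_sign l (k |: A) =
  - (koszul_sign l A * koszul_sign k (l |: A)).
Proof.
move=> nkl kA lA; rewrite !koszul_signU //.
have -> : (l < k)%N = ~~ (k < l)%N by rewrite -leqNgt ltn_neqAle eq_sym nkl.
by case: (k < l)%N; rewrite ?expr0 ?expr1 /= ?mulN1r ?mul1r ?mulrN ?opprK mulrC.
Qed.

(** A function c on sets stands for the chain that is the sum of the c(A) e_A,
so the value at A collects the faces A of the simplices l |: A. *)
Definition simplex_boundary c A : R :=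
  \sum_(l | l \notin A) koszul_sign l A * c (l |: A).

Definition toggle k c B : R :=
  if k \in B then koszul_sign k (B :\ k) * c (B :\ k) else 0.

(** The full simplex is a cone with apex k, and [toggle k] is the cone
construction: the terms in which the boundary removes another vertex l cancel by
the sign rule, which leaves l = k alone. *)
Lemma toggle_homotopy k c A :
  simplex_boundary (toggle k c) A + toggle k (simplex_boundary c) A = c A.
Proof.
rewrite /simplex_boundary {2}/toggle; case: ifPn => kA; last first.
  rewrite addr0 (bigD1 k) //= big1 ?addr0 => [|l /andP[lA nlk]].
    by rewrite /toggle setU11 setU1K // mulrA koszul_signK mul1r.
  by rewrite /toggle !inE eq_sym (negPf nlk) (negPf kA) mulr0.
rewrite [X in _ + _ * X](bigD1 k) /=; last by rewrite !inE eqxx.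
rewrite setD1K // mulrDr mulrA koszul_signK mul1r addrCA -[RHS]addr0; congr (_ + _).
rewrite mulr_sumr [X in _ + X](eq_bigl (fun l => l \notin A)); last first.
  by move=> l; rewrite !inE; case: (eqVneq l k) => [->|]; rewrite ?kA ?andbT.
rewrite -big_split big1 //= => l lA.
have nlk : l != k by apply: contraNneq lA => ->.
rewrite /toggle !inE kA orbT.
have -> : (l |: A) :\ k = l |: A :\ k.
  by apply/setP=> j; rewrite !inE; case: (eqVneq j l) => [->|]; rewrite ?nlk ?andbF.
have kAk : k \notin A :\ k by rewrite !inE eqxx.
have lAk : l \notin A :\ k by rewrite !inE (negPf lA) andbF.
have := koszul_sign_swap nlk lAk kAk; rewrite setD1K // => sw.
have -> : koszul_sign k (l |: A :\ k) =
    - (koszul_sign l (A :\ k) * (koszul_sign k (A :\ k) * koszul_sign l A)).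
  by rewrite -mulrN -sw mulrA koszul_signK mul1r.
rewrite !mulrA -mulrDl mulrN !mulrA.
by rewrite [X in - X]mulrC !mulrA koszul_signK mul1r [X in - X]mulrC addNr mul0r.
Qed.

(** The double sum is antisymmetric; the terms are paired off rather than the
sum shown to be its own opposite, which would not suffice in characteristic 2. *)
Lemma simplex_boundary_boundary c A : simplex_boundary (simplex_boundary c) A = 0.
Proof.
pose f k l := if (k \notin A) && (l \notin k |: A)
  then koszul_sign k A * (koszul_sign l (k |: A) * c (l |: (k |: A))) else 0.
have fN k l : f k l = - f l k.
  rewrite /f !inE !negb_or eq_sym.
  case: (eqVneq l k) => [_|nkl] /=; first by rewrite !andbF oppr0.
  rewrite andbC; case: ifP => [/andP[lA kA]|_]; last by rewrite oppr0.
  by rewrite !mulrA koszul_sign_swap 1?eq_sym // mulNr setUCA.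
have fk k : f k k = 0 by rewrite /f setU11 andbF.
have -> : simplex_boundary (simplex_boundary c) A = \sum_k \sum_l f k l.
  rewrite /simplex_boundary big_mkcond; apply: eq_bigr => k _; rewrite /f.
  case: (k \notin A) => /=; last by rewrite big1.
  rewrite mulr_sumr big_mkcond; apply: eq_bigr => l _; by case: ifP.
transitivity (\sum_(k < s) \sum_(l < s | (k < l)%N) f k l +
              \sum_(k < s) \sum_(l < s | (l < k)%N) f k l).
  rewrite -big_split /=; apply: eq_bigr => k _.
  rewrite (bigD1 k) //= fk add0r (bigID (fun l : 'I_s => (k < l)%N)) /=.
  by congr (_ + _); apply: eq_bigl => l; rewrite -val_eqE /=; lia.
rewrite [X in _ + X](exchange_big_dep predT) //= -big_split big1 //= => k _.
by rewrite -big_split big1 //= => l _; rewrite [X in _ + X]fN addrN.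
Qed.

End SimplexBoundary.

(** * The Koszul complex and its multigraded pieces *)

Section KoszulComplex.
Variables (K : fieldType) (s n : nat).
Implicit Types (A B : {set 'I_s}) (k l : 'I_s) (a m : 'X_{1..s}).
Implicit Types (y : {set 'I_s} -> 'rV[{mpoly K[s]}]_n) (j : 'I_n).

(** Chains of the Koszul complex of S^n are written as the coefficients y(A) of
the basis vectors e_A, in all homological degrees at once. *)
Definition koszul y A : 'rV[{mpoly K[s]}]_n :=
  \sum_(l | l \notin A) ((koszul_sign K l A)%:MP * 'X_l) *: y (l |: A).

Definition set_mnm A : 'X_{1..s} := [multinom (i \in A : nat) | i < s].

Lemma set_mnmE A k : set_mnm A k = (k \in A).
Proof. by rewrite /set_mnm mnmE. Qed.

Lemma set_mnmU1 l A : l \notin A -> set_mnm (l |: A) = (U_(l) + set_mnm A)%MM.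
Proof.
move=> lA; apply/mnmP=> i; rewrite mnmDE !set_mnmE mnm1E !inE eq_sym.
by case: eqVneq => // <-; rewrite (negPf lA).
Qed.

(** The part of multidegree a of the j-th coordinate. Here e_A has the multidegree
[set_mnm A], so that multiplying by a variable and removing it from A cancel:
the Koszul differential becomes the boundary of the simplex. *)
Definition strand a j y A : K :=
  if (set_mnm A <= a)%MM then (y A ord0 j)@_(a - set_mnm A) else 0.

Lemma mcoeff_strand y A j m : (y A ord0 j)@_m = strand (m + set_mnm A) j y A.
Proof. by rewrite /strand lem_addl addmK. Qed.

Lemma mcoeffXM l (p : {mpoly K[s]}) m :
  ('X_l * p)@_m = if (0 < m l)%N then p@_(m - U_(l)) else 0.
Proof.
rewrite mulrC; case: ifP => [ml|].
  by rewrite -[in LHS](@submK _ U_(l)%MM m) ?lep1mP -?lt0n // addmC mcoeffMX.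
move=> ml; apply: memN_msupp_eq0; rewrite (perm_mem (msuppMX _ _)).
by apply/mapP=> -[m' _ mE]; move: ml; rewrite mE mnmDE mnm1E eqxx.
Qed.

Lemma strand_koszul a j y A :
  strand a j (koszul y) A = simplex_boundary (strand a j y) A.
Proof.
rewrite {1}/strand /simplex_boundary /koszul; case: ifPn => [Aa|nAa]; last first.
  rewrite big1 // => l lA; rewrite /strand set_mnmU1 // ifN ?mulr0 //.
  by apply: contra nAa; apply: lepm_trans; apply: lem_addl.
rewrite summxE raddf_sum; apply: eq_bigr => l lA /=.
rewrite mxE -mulrA mcoeffCM mcoeffXM; congr (_ * _).
rewrite /strand set_mnmU1 // addmC submDA; congr (if _ then _ else _).
apply/idP/mnm_lepP => [al i|/(_ l)].
  rewrite mnmDE; have := mnm_lepP Aa i; rewrite mnm1E.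
  by case: eqVneq => [<-|_]; move: al; rewrite mnmBE; lia.
by rewrite mnmDE mnmBE mnm1E eqxx; lia.
Qed.

Lemma koszul_koszul y A : koszul (koszul y) A = 0.
Proof.
apply/rowP=> j; apply/mpolyP=> m; rewrite mxE mcoeff0 mcoeff_strand.
rewrite strand_koszul -[RHS](simplex_boundary_boundary (strand (m + set_mnm A) j y) A).
by apply: eq_bigr => l _; rewrite strand_koszul.
Qed.

(** In every multidegree a, some variable that divides t^a may be chosen for
toggling; where none is chosen the homotopy is 0. *)
Section Contraction.
Variable pick : 'X_{1..s} -> option 'I_s.
Hypothesis pick_gt0 : forall a k, pick a = Some k -> (0 < a k)%N.

(** When k is not in A, the division by t_k is exact on the selected terms, since
k occurs in their multidegree and not in that of e_A. *)
Definition lower_pick A k (p : {mpoly K[s]}) : {mpoly K[s]} :=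
  \sum_(m <- msupp p | pick (m + set_mnm A)%MM == Some k)
     p@_m *: 'X_[m - U_(k)].

Definition contraction y B : 'rV[{mpoly K[s]}]_n :=
  \row_j \sum_(k in B)
     (koszul_sign K k (B :\ k))%:MP * lower_pick (B :\ k) k (y (B :\ k) ord0 j).

Lemma mcoeff_lower_pick A k (p : {mpoly K[s]}) m : k \notin A ->
  (lower_pick A k p)@_m =
  if pick (m + U_(k) + set_mnm A)%MM == Some k then p@_(m + U_(k)) else 0.
Proof.
move=> kA; rewrite /lower_pick.
have mk m' : pick (m' + set_mnm A)%MM == Some k ->
    (m' == m + U_(k))%MM = (m' - U_(k) == m)%MM.
  move=> /eqP/pick_gt0; rewrite mnmDE set_mnmE (negPf kA) addn0 => m'k.
  apply/eqP/eqP => [->|<-]; first by rewrite addmK.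
  by rewrite submK // lep1mP -lt0n.
rewrite big_mkcond raddf_sum /=.
pose c m' := if pick (m' + set_mnm A)%MM == Some k then p@_m' else 0.
rewrite -/(c _) (eq_bigr (fun m' => if m' == (m + U_(k))%MM then c m' else 0)).
  have [sm|nsm] := boolP ((m + U_(k))%MM \in msupp p).
    rewrite (bigD1_seq _ sm) ?msupp_uniq //= eqxx big1 ?addr0 // => m'.
    by move/negPf ->.
  rewrite -big_mkcond /c (memN_msupp_eq0 nsm) if_same big_seq_cond big1 //.
  by move=> m' /andP[m'p /eqP m'E]; rewrite -m'E m'p in nsm.
move=> m' _; rewrite /c; case: ifP => [pm'|_]; last by rewrite mcoeff0 if_same.
by rewrite mcoeffZ mcoeffX -mk //; case: eqP; rewrite ?mulr1 ?mulr0.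
Qed.

Lemma mcoeff_contraction y B j m :
  (contraction y B ord0 j)@_m =
  if pick (m + set_mnm B)%MM is Some k then
    if k \in B then koszul_sign K k (B :\ k) * (y (B :\ k) ord0 j)@_(m + U_(k))
    else 0
  else 0.
Proof.
rewrite mxE raddf_sum /=.
have EB k : k \in B -> (m + U_(k) + set_mnm (B :\ k))%MM = (m + set_mnm B)%MM.
  by move=> kB; rewrite -addmA -set_mnmU1 ?setD1K // !inE eqxx.
rewrite (eq_bigr (fun k => if pick (m + set_mnm B)%MM == Some k then
  koszul_sign K k (B :\ k) * (y (B :\ k) ord0 j)@_(m + U_(k)) else 0)); last first.
  move=> k kB; rewrite mcoeffCM mcoeff_lower_pick ?EB ?inE ?eqxx //.
  by case: ifP => //; rewrite mulr0.
case: pick => [k|]; last by rewrite big1.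
case: ifPn => kB.
  rewrite (bigD1 k) //= eqxx big1 ?addr0 // => l /andP[_ nlk].
  by rewrite ifN //; apply: contra nlk => /eqP[->].
by rewrite big1 // => l lB; rewrite ifN //; apply: contra kB => /eqP[->].
Qed.

(** The chosen variable divides t^a, which is what makes the truncation of
[strand] compatible with toggling. *)
Lemma strand_contraction a j y B :
  strand a j (contraction y) B =
  if pick a is Some k then toggle k (strand a j y) B else 0.
Proof.
rewrite {1}/strand; case: ifPn => Ba.
  rewrite mcoeff_contraction submK //; case: pick => // k.
  rewrite /toggle; case: ifP => // kB; congr (_ * _).
  have kBk : k \notin B :\ k by rewrite !inE eqxx.
  have Bka : (set_mnm (B :\ k) <= a)%MM.
    by apply: lepm_trans Ba; rewrite -[in X in lem _ X](setD1K kB) set_mnmU1 ?lem_addl.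
  rewrite /strand Bka; congr (_@__).
  apply: (@addIm _ (set_mnm (B :\ k))); rewrite submK // -addmA -set_mnmU1 //.
  by rewrite setD1K // submK.
case pa: (pick a) => [k|] //; rewrite /toggle; case: ifP => // kB.
rewrite /strand ifN ?mulr0 //; apply: contra Ba => /mnm_lepP Bka.
apply/mnm_lepP=> i; have := Bka i; rewrite !set_mnmE !inE.
by case: eqVneq => // ->; rewrite kB => _; apply: pick_gt0.
Qed.

(** [toggle_homotopy] in the multidegrees where a variable is chosen, and 0 in the
others. *)
Lemma contraction_homotopy y A j m :
  (koszul (contraction y) A ord0 j)@_m + (contraction (koszul y) A ord0 j)@_m =
  if pick (m + set_mnm A)%MM is Some _ then (y A ord0 j)@_m else 0.
Proof.
rewrite !mcoeff_strand strand_koszul strand_contraction.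
have -> : simplex_boundary (strand (m + set_mnm A) j (contraction y)) A =
   if pick (m + set_mnm A)%MM is Some k then
   simplex_boundary (toggle k (strand (m + set_mnm A) j y)) A else 0.
  rewrite /simplex_boundary; case E: pick => [k|].
    by apply: eq_bigr => l _; rewrite strand_contraction E.
  by rewrite big1 // => l _; rewrite strand_contraction E mulr0.
case: pick => [k|]; last by rewrite addr0.
rewrite -[RHS](toggle_homotopy k); congr (_ + _); rewrite /toggle.
by case: ifP => // _; rewrite strand_koszul.
Qed.

End Contraction.
End KoszulComplex.

Section KoszulMaps.
Variables (K : fieldType) (s : nat).
Implicit Types (A B : {set 'I_s}) (k l : 'I_s) (a m : 'X_{1..s}).
Local Notation S := {mpoly K[s]}.

Lemma eq_koszul n (y z : {set 'I_s} -> 'rV[S]_n) :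
  y =1 z -> koszul y =1 koszul z.
Proof. by move=> yz A; apply: eq_bigr => l _; rewrite yz. Qed.

Lemma koszulB n (y z : {set 'I_s} -> 'rV[S]_n) A :
  koszul (fun B => y B - z B) A = koszul y A - koszul z A.
Proof. by rewrite -sumrB; apply: eq_bigr => l _; rewrite scalerBr. Qed.

Lemma koszulD n (y z : {set 'I_s} -> 'rV[S]_n) A :
  koszul (fun B => y B + z B) A = koszul y A + koszul z A.
Proof. by rewrite -big_split; apply: eq_bigr => l _; rewrite scalerDr. Qed.

Lemma koszul_mulmx n n' (D : 'M[S]_(n, n')) (y : {set 'I_s} -> 'rV[S]_n) A :
  koszul (fun B => y B *m D) A = koszul y A *m D.
Proof. by rewrite mulmx_suml; apply: eq_bigr => l _; rewrite scalemxAl. Qed.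

Definition support_pick a : option 'I_s := [pick k | (0 < a k)%N].

Lemma support_pick_gt0 a k : support_pick a = Some k -> (0 < a k)%N.
Proof. by rewrite /support_pick; case: pickP => // l al [<-]. Qed.

(** Every multidegree except 0 has a variable to toggle, and in multidegree 0 the
only basis vector is e_set0 with a constant coefficient. *)
Lemma koszul_exact n (u : {set 'I_s} -> 'rV[S]_n) :
    (forall A, koszul u A = 0) -> (forall j, (u set0 ord0 j)@_0 = 0) ->
  forall A, koszul (contraction support_pick u) A = u A.
Proof.
move=> du0 u0 A; apply/rowP=> j; apply/mpolyP=> m.
have := contraction_homotopy support_pick_gt0 u A j m.
rewrite (mcoeff_contraction support_pick_gt0).
have -> : forall o : option 'I_s, (if o is Some k then if k \in A
   then koszul_sign K k (A :\ k) * (koszul u (A :\ k) ord0 j)@_(m + U_(k))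
   else 0 else 0) = 0.
  by case=> // k; rewrite du0 mxE mcoeff0 mulr0 if_same.
rewrite addr0 => ->; rewrite /support_pick; case: pickP => // supp0.
have -> : A = set0.
  by apply/setP=> k; have := supp0 k; rewrite mnmDE set_mnmE inE; case: (k \in A); lia.
have -> : m = 0%MM; last by rewrite u0.
by apply/mnmP=> k; have := supp0 k; rewrite mnmDE mnm0E; lia.
Qed.

(** Chains of homological degree p and internal degree e, where e_A has degree
|A| and the j-th basis vector of the coefficient module has degree sh j. *)
Definition koszul_homog p (e : int) n (sh : 'I_n -> int)
    (y : {set 'I_s} -> 'rV[S]_n) :=
  forall A j m, (y A ord0 j)@_m != 0 ->
    #|A| = p /\ (mdeg m + #|A|)%:Z + sh j = e.

Lemma koszul_homog_contraction p e n (sh : 'I_n -> int) pick y :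
    (forall a k, pick a = Some k -> (0 < a k)%N) ->
  koszul_homog p e sh y -> koszul_homog p.+1 e sh (contraction pick y).
Proof.
move=> pick_gt0 hy A j m; rewrite mcoeff_contraction //.
case: (pick _) => [k|]; last by rewrite eqxx.
case: ifP => [kA|]; last by rewrite eqxx.
rewrite mulf_eq0 => /norP[_] /hy[<-]; rewrite mdegD mdeg1 => <-.
by rewrite (cardsD1 k A) kA; split; rewrite /= ?addnA.
Qed.

Lemma koszul_homog_mulmx p e n n' (sh : 'I_n -> int) (sh' : 'I_n' -> int)
    (D : 'M[S]_(n, n')) y :
    (forall i i', zhomog (sh i - sh' i') (D i i')) ->
  koszul_homog p e sh y -> koszul_homog p e sh' (fun A => y A *m D).
Proof.
move=> hD hy A j m; rewrite -mcoeff_msupp mxE => /msupp_sum_le/flattenP[/= t].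
case/mapP=> i _ -> /msuppM_le/allpairsP[[m1 m2] /= [m1y m2D ->]].
have := hD _ _ _ m2D; have [|-> E] := hy A i m1; first by rewrite -mcoeff_msupp.
by rewrite mdegD => E2; split=> //; lia.
Qed.

End KoszulMaps.

(** * The Koszul complex of a monomial quotient *)

Section MonomialQuotient.
Variables (K : fieldType) (s : nat) (I : idealr {mpoly K[s]}).
Variable G : {fset 'X_{1..s}}.
Hypothesis genG : generated_by_monomials I G.
Implicit Types (A B : {set 'I_s}) (k l : 'I_s) (a m : 'X_{1..s}).
Local Notation S := {mpoly K[s]}.

Lemma mem_monomial_ideal (p : S) :
  p \in I <-> forall m, p@_m != 0 -> has (fun g => (g <= m)%MM) G.
Proof.
split=> [/genG[c ->] m|hp].
  rewrite -mcoeff_msupp => /msupp_sum_le/flattenP[/= t /mapP[g]].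
  rewrite filter_predT => gG -> .
  rewrite (perm_mem (msuppMX _ _)) => /mapP[m' _ ->].
  by apply/hasP; exists g => //; apply: lem_addr.
have XI g : g \in G -> 'X_[g] \in I.
  move=> gG; apply/genG; exists (fun g' => (g' == g)%:R).
  rewrite (bigD1_seq g) ?fset_uniq //= eqxx mul1r big1 ?addr0 // => g' /negPf ->.
  by rewrite mul0r.
rewrite (mpolyE p) big_seq; apply: rpred_sum => m mp.
rewrite mcoeff_msupp in mp; have /hasP[g gG gm] := hp m mp.
rewrite -(submK gm) mpolyXD -mul_mpolyC mulrA.
exact/idealMr/XI.
Qed.

Definition excess_pick a : option 'I_s := [pick k | (gamma G k < a k)%N].

Lemma excess_pickP a k : excess_pick a = Some k -> (gamma G k < a k)%N.
Proof. by rewrite /excess_pick; case: pickP => // l al [<-]. Qed.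

Lemma excess_pick_gt0 a k : excess_pick a = Some k -> (0 < a k)%N.
Proof. by move/excess_pickP; apply: leq_ltn_trans. Qed.

Lemma leq_gamma g k : g \in G -> (g k <= gamma G k)%N.
Proof. by move=> gG; rewrite /gamma (bigD1_seq g) ?fset_uniq //= leq_maxl. Qed.

(** The toggled variable has a_k > gamma_k, so dividing a monomial by it leaves an
exponent at least gamma_k at k: every generator that divides the monomial
still divides the quotient. *)
Lemma contraction_ideal (z : {set 'I_s} -> 'rV[S]_1) A :
  (forall B, z B ord0 ord0 \in I) -> contraction excess_pick z A ord0 ord0 \in I.
Proof.
move=> zI; apply/mem_monomial_ideal => m.
rewrite (mcoeff_contraction excess_pick_gt0).
case E: (excess_pick _) => [k|]; last by rewrite eqxx.
case: ifP => kA; last by rewrite eqxx.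
rewrite mulf_eq0 => /norP[_] /(mem_monomial_ideal _).1.
move=> /(_ (zI _))/hasP[g gG /mnm_lepP gm]; apply/hasP; exists g => //.
apply/mnm_lepP=> i; have := gm i; rewrite mnmDE mnm1E.
case: eqVneq => [<- _|_]; last by rewrite addn0.
have := excess_pickP E; rewrite mnmDE set_mnmE kA addn1 ltnS.
exact/leq_trans/leq_gamma.
Qed.

Lemma koszul_ideal (z : {set 'I_s} -> 'rV[S]_1) A :
  (forall B, z B ord0 ord0 \in I) -> koszul z A ord0 ord0 \in I.
Proof.
by move=> zI; rewrite summxE rpred_sum // => l _; rewrite mxE idealMr.
Qed.

(** The basis vectors t^m e_A of Koszul degree p and degree e whose multidegree
admits no toggling all vanish in the Koszul complex of S/I; this is what makes
its homology vanish there. *)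
Definition bounded_cells_in_ideal (e : int) (p : nat) :=
  forall A m, #|A| = p -> (mdeg m + p)%:Z = e ->
    (forall k, (m k + (k \in A) <= gamma G k)%N) -> has (fun g => (g <= m)%MM) G.

Lemma koszul_quotient_exact e p (z : {set 'I_s} -> 'rV[S]_1) A :
    bounded_cells_in_ideal e p -> koszul_homog p e (fun=> 0) z ->
    (forall B, koszul z B ord0 ord0 \in I) ->
  z A ord0 ord0 - koszul (contraction excess_pick z) A ord0 ord0 \in I.
Proof.
move=> cellsI hz dzI.
rewrite -[_ - _](subrK (contraction excess_pick (koszul z) A ord0 ord0)).
apply: rpredD; last exact: contraction_ideal.
apply/mem_monomial_ideal => m; rewrite -addrA -opprD mcoeffB mcoeffD.
rewrite (contraction_homotopy excess_pick_gt0) /excess_pick.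
case: pickP => [k _|none]; first by rewrite subrr eqxx.
rewrite subr0 => /hz[pA]; rewrite addr0 pA => mE.
apply: (cellsI A) => // k.
by have := none k; rewrite mnmDE set_mnmE => /negbT; rewrite -leqNgt.
Qed.

Variable F : minimal_graded_resolution I.
Local Notation d := (mgr_diff F).
Local Notation shift := (mgr_shift (m := F)).

Lemma pi_ideal_eq0 (p : S) :
  \pi_{ideal_quot I}%qT p = 0 <-> p \in I.
Proof.
rewrite -[p in p \in I]subr0 Quotient.idealrBE rmorph0.
by split => [->|/eqP].
Qed.

(** Lifting the images of the basis of F_0 to homogeneous polynomials makes the
augmentation a matrix over S read modulo I, to be treated like a further
differential. *)
Lemma augmentation_matrix : exists D : 'M[S]_(mgr_rank F 0, 1),
  [/\ forall i j, zhomog (shift i - 0) (D i j),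
      forall u : 'rV_(mgr_rank F 0), (u *m D) ord0 ord0 \in I <-> exists v, u = v *m d 0 &
      forall q, exists u : 'rV_(mgr_rank F 0), (u *m D) ord0 ord0 - q \in I].
Proof.
have [P hP] : exists P : 'I_(mgr_rank F 0) -> S, forall i,
    zhomog (shift i) (P i) /\ mgr_augb i = \pi_{ideal_quot I}%qT (P i).
  have aug_rep i : exists p : S,
      zhomog (shift i) p /\ mgr_augb i = \pi_{ideal_quot I}%qT p.
    by have [p] := mgr_aug_graded i; exists p.
  by have [P hP] := fin_all_exists aug_rep; exists P.
have augE u : mgr_aug u = \pi_{ideal_quot I}%qT ((u *m \col_i P i) ord0 ord0).
  rewrite /mgr_aug mxE rmorph_sum; apply: eq_bigr => i _.
  by rewrite mxE rmorphM (hP i).2.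
exists (\col_i P i); split=> [i j|u|q].
- by rewrite mxE subr0; apply: (hP i).1.
- by rewrite -mgr_exact0 augE pi_ideal_eq0.
have [u] := mgr_aug_surj F (\pi_{ideal_quot I}%qT q); rewrite augE => uq.
by exists u; apply/pi_ideal_eq0; rewrite rmorphB /= uq subrr.
Qed.

End MonomialQuotient.

(** * Comparison of a minimal resolution with the Koszul complex *)

Section Zigzag.
Variables (K : fieldType) (s : nat) (I : idealr {mpoly K[s]}).
Variable G : {fset 'X_{1..s}}.
Hypothesis genG : generated_by_monomials I G.
Variable F : minimal_graded_resolution I.
Implicit Types (A B : {set 'I_s}).
Local Notation S := {mpoly K[s]}.
Local Notation d := (mgr_diff F).
Local Notation rank := (mgr_rank F).
Local Notation shift := (mgr_shift (m := F)).

Variable D : 'M[S]_(rank 0, 1).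
Hypothesis D_graded : forall i j, zhomog (shift i - 0) (D i j).
Hypothesis D_exact :
  forall u : 'rV_(rank 0), (u *m D) ord0 ord0 \in I <-> exists v, u = v *m d 0.
Hypothesis D_surj :
  forall q, exists u : 'rV_(rank 0), (u *m D) ord0 ord0 - q \in I.

(** By exactness of F this says that the Koszul boundary of y has values in the
image of F_(q+1); the map out of F_q is the augmentation when q = 0. *)
Definition cycle_mod_image q : ({set 'I_s} -> 'rV[S]_(rank q)) -> Prop :=
  match q with
  | 0 => fun y => forall A, (koszul y A *m D) ord0 ord0 \in I
  | q'.+1 => fun y => forall A, koszul y A *m d q' = 0
  end.

Lemma cycle_mod_imageP q (y : {set 'I_s} -> 'rV[S]_(rank q)) :
  cycle_mod_image y <-> forall A, exists v, koszul y A = v *m d q.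
Proof.
by case: q y => [|q] y; split=> h A; first [exact/D_exact | exact/mgr_exactS].
Qed.

(** By induction on q. The image of y in F_(q-1) is a Koszul cycle without constant
coefficients, hence the boundary of some x of Koszul degree one higher.
By induction x is a boundary up to an element v d; then y differs from the
boundary of v by a cycle of F. For q = 0 the image of y in S/I is a Koszul cycle,
hence a boundary by the hypothesis on the cells. *)
Lemma koszul_zigzag e q p (y : {set 'I_s} -> 'rV[S]_(rank q)) :
    bounded_cells_in_ideal G e (p + q) ->
    koszul_homog p e (@shift q) y -> cycle_mod_image y ->
  exists w v, forall A, y A = koszul w A + v A *m d q.
Proof.
elim: q p y => [|q IHq] p y cellsI hy cy.
  pose z A := y A *m D.
  have hz : koszul_homog p e (fun=> 0) z by apply: koszul_homog_mulmx hy.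
  have dzI B : koszul z B ord0 ord0 \in I by rewrite koszul_mulmx cy.
  have [w hw] := fin_all_exists
    (fun A => D_surj (contraction (excess_pick G) z A ord0 ord0)).
  have hv A : exists v, y A - koszul w A = v *m d 0.
    apply/D_exact; rewrite mulmxBl -koszul_mulmx mxE [X in _ + X]mxE.
    have := koszul_quotient_exact genG A _ hz dzI; rewrite addn0 in cellsI.
    move=> /(_ cellsI) zI.
    rewrite -(subrK (koszul (contraction (excess_pick G) z) A ord0 ord0)
                    ((y A *m D) _ _)).
    rewrite -addrA; apply: rpredD; first exact: zI.
    rewrite -rpredN opprB.
    have := koszul_ideal (z := fun B => w B *m D - contraction (excess_pick G) z B) A.
    rewrite koszulB mxE [X in _ + X]mxE; apply.
    by move=> B; rewrite mxE [X in _ + X]mxE.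
  have [v vE] := fin_all_exists hv.
  by exists w, v => A; rewrite -vE addrC subrK.
pose u A := y A *m d q.
have hu : koszul_homog p e (@shift q) u.
  by apply: koszul_homog_mulmx hy => i j; apply: mgr_diff_graded.
have du0 A : koszul u A = 0 by rewrite koszul_mulmx cy.
(* Minimality of F is what excludes the homology K of the Koszul complex. *)
have u0 j : (u set0 ord0 j)@_0 = 0.
  rewrite mxE raddf_sum big1 //= => i _.
  by rewrite rmorphM /= mgr_minimal mulr0.
pose x := contraction (@support_pick s) u.
have dx A : koszul x A = y A *m d q by apply: koszul_exact.
have hx : koszul_homog p.+1 e (@shift q) x.
  by apply: koszul_homog_contraction hu => a k; apply: support_pick_gt0.
have [||w [v vE]] := IHq p.+1 x _ hx; first by rewrite addSnnS.
  by apply/cycle_mod_imageP=> A; exists (y A).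
have hv A : exists v', y A - koszul v A = v' *m d q.+1.
  apply/mgr_exactS; rewrite mulmxBl -dx (eq_koszul vE) koszulD koszul_koszul.
  by rewrite koszul_mulmx add0r subrr.
have [v' v'E] := fin_all_exists hv.
by exists v, v' => A; rewrite -v'E addrC subrK.
Qed.

End Zigzag.

Section BettiCells.
Variables (K : fieldType) (s : nat) (I : idealr {mpoly K[s]}).
Variable G : {fset 'X_{1..s}}.
Hypothesis genG : generated_by_monomials I G.

(** A basis vector of degree j, as a chain concentrated at the empty set, satisfies
the zigzag; evaluated at the empty set, the resulting decomposition has
no constant coefficients, while a basis vector has one. *)
Lemma betti_eq0 (F : minimal_graded_resolution I) i j :
  bounded_cells_in_ideal G j i -> betti F i j = 0%N.
Proof.
move=> cellsI; apply: eq_card0 => k; apply/negP; rewrite inE => /eqP kj.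
have [D [D_graded D_exact D_surj]] := augmentation_matrix F.
pose y (A : {set 'I_s}) : 'rV[{mpoly K[s]}]_(mgr_rank F i) :=
  if A == set0 then delta_mx ord0 k else 0.
have dy A : koszul y A = 0.
  rewrite /koszul big1 // => l lA; rewrite /y ifN ?scaler0 //.
  by apply/set0Pn; exists l; rewrite setU11.
have hy : koszul_homog 0 j (@mgr_shift _ _ _ F i) y.
  move=> A k' m; rewrite /y; case: (eqVneq A) => [->|_]; last by rewrite mxE mcoeff0 eqxx.
  rewrite mxE eqxx /= cards0; case: (eqVneq k') => [->|_]; last by rewrite mcoeff0 eqxx.
  rewrite mcoeff1; case: (eqVneq m) => [->|_]; last by rewrite eqxx.
  by rewrite mdeg0 add0r kj.
have cy : cycle_mod_image D y.
  by apply/(cycle_mod_imageP D_exact) => A; exists 0; rewrite dy mul0mx.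
have [w [v /(_ set0)]] :=
  koszul_zigzag (p := 0) genG D_graded D_exact D_surj cellsI hy cy.
move/(congr1 (fun u : 'rV_(mgr_rank F i) => (u ord0 k)@_0)).
rewrite /y eqxx mxE !eqxx mcoeff1 eqxx mxE mcoeffD.
rewrite summxE raddf_sum big1 /= => [|l _]; last first.
  by rewrite mxE -mulrA mcoeffCM mcoeffXM mnm0E mulr0.
rewrite mxE raddf_sum big1 /= => [|l _].
  by rewrite addr0 => /eqP; rewrite oner_eq0.
by rewrite rmorphM /= mgr_minimal mulr0.
Qed.

End BettiCells.

(** * A lower bound for the Krull dimension *)

(** A morphism to a domain that vanishes on I factors through the quotient. *)
Lemma kernel_prime_quotient (R : comNzRingType) (I : idealr R)
    (T : idomainType) (f : {rmorphism R -> T}) :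
  (forall p, p \in I -> f p = 0) ->
  {P : prime_idealr {ideal_quot I} |
    forall p, (\pi_{ideal_quot I}%qT p \in P) = (f p == 0)}.
Proof.
move=> fI; pose Q := {ideal_quot I}.
pose S : {pred Q} := fun q => f (repr q) == 0.
have SE p : (\pi_Q%qT p \in S) = (f p == 0).
  rewrite unfold_in /S; congr (_ == 0); apply/eqP.
  by rewrite -subr_eq0 -rmorphB fI // Quotient.idealrBE reprK.
have SP q : exists2 p, q = \pi_Q%qT p & (q \in S) = (f p == 0).
  by exists (repr q); rewrite ?reprK.
have S_ideal : idealr_closed S.
  split=> [||q u v].
  - by rewrite -(rmorph0 \pi_Q%qT) SE rmorph0.
  - by rewrite -(rmorph1 \pi_Q%qT) SE rmorph1 oner_eq0.
  have [q' -> _] := SP q; have [u' -> ->] := SP u; have [v' -> ->] := SP v.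
  move=> /eqP fu /eqP fv; rewrite -rmorphM -rmorphD SE.
  by rewrite rmorphD rmorphM fu fv mulr0 addr0.
have S_prime : prime_idealr_closed S.
  move=> u v; have [u' -> ->] := SP u; have [v' -> ->] := SP v.
  by rewrite -rmorphM SE rmorphM mulf_eq0.
pose M1 := isIdealr.Build Q S S_ideal.
pose M2 := isPrimeIdealrClosed.Build Q S S_prime.
pose P : prime_idealr Q := HB.pack S M1 M2.
by exists P => p; rewrite -SE.
Qed.

Section Krull.
Variables (K : fieldType) (s : nat).
Implicit Types (U T : {set 'I_s}) (m g : 'X_{1..s}).
Local Notation S := {mpoly K[s]}.

Definition kill_vars U : S -> S :=
  mmap (@mpolyC s K) (fun k => if k \in U then 0 else 'X_k).

HB.instance Definition _ U := GRing.RMorphism.on (kill_vars U).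

Lemma mcoeff_kill_vars U (p : S) m :
  (kill_vars U p)@_m = if [exists k in U, (0 < m k)%N] then 0 else p@_m.
Proof.
have mmap1E m' : mmap1 (fun k => if k \in U then 0 else 'X_k : S) m' =
    if [exists k in U, (0 < m' k)%N] then 0 else 'X_[m'].
  rewrite /mmap1; case: ifPn => [/exists_inP[k kU mk]|/exists_inPn none].
    by rewrite (bigD1 k) //= kU expr0n eqn0Ngt mk mul0r.
  rewrite mpolyXE_id; apply: eq_bigr => k _; case: ifP => // /none.
  by rewrite -eqn0Ngt => /eqP ->; rewrite !expr0.
rewrite /kill_vars /mmap raddf_sum [in RHS](mpolyE p) raddf_sum /=.
case: ifP => mU; [rewrite big1 // => m' _ | apply: eq_bigr => m' _];
  rewrite mmap1E mcoeffCM ?mcoeffZ.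
  case: ifP => m'U; first by rewrite mcoeff0 mulr0.
  by rewrite mcoeffX; case: eqP m'U => [->|_]; rewrite ?mU ?mulr0.
case: ifP => // m'U; rewrite mcoeffX mcoeff0.
by case: eqP m'U => [->|]; rewrite ?mU ?mulr0.
Qed.

Variables (I : idealr S) (G : {fset 'X_{1..s}}).
Hypothesis genG : generated_by_monomials I G.

(** The hypothesis says that I meets the polynomial ring in the variables of T
only in 0. The i-th prime of the chain is generated by the variables outside T
and the first i variables of T. *)
Lemma krull_dim_ge_card_free_vars T d :
    (forall g, g \in G -> exists2 k, k \notin T & (0 < g k)%N) ->
  is_krull_dim {ideal_quot I} d -> (#|T| <= d)%N.
Proof.
move=> GT [_]; apply.
pose U i : {set 'I_s} := [set k | k \notin drop i (enum T)].
have killI i p : p \in I -> kill_vars (U i) p = 0.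
  move/(mem_monomial_ideal genG) => pI; apply/mpolyP=> m.
  rewrite mcoeff_kill_vars mcoeff0; case: ifP => // /negbT/exists_inPn mU.
  apply/eqP/negPn; apply/negP => /pI/hasP[g /GT[k kT gk] /mnm_lepP/(_ k) gm].
  have /mU : k \in U i by rewrite inE; apply: contra kT => /mem_drop; rewrite mem_enum.
  by rewrite (leq_trans gk gm).
pose P i := sval (kernel_prime_quotient (killI i)).
have PE i p : (\pi_{ideal_quot I}%qT p \in P i) = (kill_vars (U i) p == 0).
  exact: svalP (kernel_prime_quotient (killI i)) p.
have sU i : U i \subset U i.+1.
  apply/subsetP=> k; rewrite !inE; apply: contra; rewrite -addn1 addnC -drop_drop.
  exact: mem_drop.
exists P => i iT; split=> [q|sP].
  rewrite -[q]reprK !PE => /eqP q0; apply/eqP/mpolyP=> m.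
  move/mpolyP/(_ m): q0; rewrite !mcoeff_kill_vars mcoeff0.
  case: ifP => [/exists_inP[k kU mk] _|_ ->]; last by rewrite if_same.
  by rewrite ifT //; apply/exists_inP; exists k => //; apply: (subsetP (sU i)).
have iE : (i < size (enum T))%N by rewrite -cardE.
have [k0 _] : exists k, k \in T by apply/card_gt0P; apply: leq_ltn_trans iT.
pose k := nth k0 (enum T) i.
have dropE : drop i (enum T) = k :: drop i.+1 (enum T) by rewrite (drop_nth k0).
have killX U0 : (kill_vars U0 'X_k == 0) = (k \in U0).
  rewrite /kill_vars mmapX mmap1U; case: ifP => _; first by rewrite eqxx.
  by rewrite -msupp_eq0 msuppX.
have := sP (\pi_{ideal_quot I}%qT 'X_k); rewrite !PE !killX !inE dropE inE eqxx /=.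
move=> absurd; have := drop_uniq i (enum_uniq T); rewrite dropE => /andP[kd _].
by have := absurd kd.
Qed.

(** A bounded monomial outside I reaches its bound gamma_k only on a set T of
variables to which [krull_dim_ge_card_free_vars] applies, and it loses at least
1 at every other occurring variable. *)
Lemma bounded_cells_above_krull d e p :
    is_krull_dim {ideal_quot I} d ->
    d%:Z + \sum_(i < s | occurs G i) ((gamma G i)%:Z - 1) < e - p%:Z ->
  bounded_cells_in_ideal G e p.
Proof.
move=> dimd large A m Ap mE mA; apply/negPn/negP => /hasPn mI.
have mg k : (m k <= gamma G k)%N by apply: leq_trans (mA k); rewrite leq_addr.
pose T := [set k | occurs G k && (m k == gamma G k)].
have Td : (#|T| <= d)%N.
  apply: krull_dim_ge_card_free_vars dimd => g gG.
  have [k /andP[kT gk]|none] := pickP (fun k => (k \notin T) && (0 < g k)%N).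
    by exists k.
  case/negP: (mI g gG); apply/mnm_lepP=> k.
  have := none k; rewrite inE; case: (boolP (occurs G k && _)) =>
    [/andP[_ /eqP ->] _|_ /=].
    exact: leq_gamma.
  by rewrite lt0n => /negbFE/eqP ->.
have Posz_sum (f : 'I_s -> nat) : (\sum_k f k)%N%:Z = \sum_k (f k)%:Z.
  exact: (big_morph Posz PoszD).
have : (mdeg m)%:Z <= #|T|%:Z + \sum_(i < s | occurs G i) ((gamma G i)%:Z - 1).
  rewrite mdegE -sum1_card [X in (_ <= X%:Z + _)]big_mkcond /=.
  rewrite [X in (_ <= _ + X)]big_mkcond /=.
  rewrite !Posz_sum -big_split /=.
  apply: ler_sum => k _; rewrite inE; have := mg k.
  case: (boolP (occurs G k)) => [occ|nocc] /=; first by case: eqP; lia.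
  suff -> : gamma G k = 0%N by lia.
  apply/eqP; rewrite -leqn0; apply/bigmax_leqP_seq => g gG _.
  by rewrite leqNgt; apply: contra nocc => gk; apply/hasP; exists g.
by move: large; lia.
Qed.
End Krull.

Theorem proposition3p4 (K : fieldType) (s : nat) (I : idealr {mpoly K[s]})
    (G : {fset 'X_{1..s}}) (hG : minimal_monomial_generators I G)
    (r : int) (d : nat)
    (hr : is_regularity I r) (hd : is_krull_dim {ideal_quot I} d) :
  r <= d%:Z + \sum_(i < s | occurs G i) ((gamma G i)%:Z - 1).
Proof.
have [F [[i [j [bij ->]]] _]] := hr.
rewrite leNgt; apply/negP => large; apply: bij.
exact: (betti_eq0 hG.1) (bounded_cells_above_krull hG.1 hd large).
Qed.
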